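(* Let $\mathcal{Z}\subset\mathbb{R}^d$ be a sample space, $P$ a probability distribution on $\mathcal{Z}$, $z_1,\dots,z_n$ iid samples from $P$, $\mathcal{F}$ a function class, $\ell:\mathcal{F}\times\mathcal{Z}\to\mathbb{R}$ a loss function, and $f^*\in\arg\min_{f\in\mathcal{F}}\mathbb{E}_P[\ell(f,z)]$. Let $P_0$ be a baseline distribution on $\mathcal{Z}$ constructed from the samples. Suppose that for a given $0<\delta<1$ we construct an ambiguity set $\mathcal{K}=\{Q:D_\phi(Q\|P_0)\le\eta\}$ such that (i) (high-confidence ambiguity set) $\mathbb{P}[P\in\mathcal{K}]\ge1-\delta/2$; (ii) (bound of DRO above the baseline) $\max_{Q\in\mathcal{K}}\mathbb{E}_Q[\ell(f^*,z)]-\mathbb{E}_{P_0}[\ell(f^*,z)]\le C_1(\ell(f^*,\cdot),\sqrt\eta,\phi)$; (iii) (approximation error) $\mathbb{E}_{P_0}[\ell(f^*,z)]-\mathbb{E}_P[\ell(f^*,z)]\le C_2(\ell(f^*,\cdot),n,\delta)$ with probability at least $1-\delta/2$, where $C_1$ and $C_2$ are quantities that depend on the respective arguments. Then the $\phi$-divergence DRO solution $$f^*_{\phi\text{-dro}}\in\arg\min_{f\in\mathcal{F}}\ \max_{Q:\,D_\phi(Q\|P_0)\le\eta}\mathbb{E}_Q[\ell(f,z)]$$ satisfies $$\mathbb{E}_P[\ell(f^*_{\phi\text{-dro}},z)]-\mathbb{E}_P[\ell(f^*,z)]\le C_1(\ell(f^*,\cdot),\sqrt\eta,\phi)+C_2(\ell(f^*,\cdot),n,\delta)$$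 with probability at least $1-\delta$.
   Context: Probabilities $\mathbb{P}$ are over the samples $z_1,\dots,z_n$ (on which $P_0$, $\mathcal{K}$ and $f^*_{\phi\text{-dro}}$ depend); $\mathbb{E}_Q[\ell(f,z)]$ is the expectation over $z\sim Q$ with $f$ held fixed. For probability distributions $Q_1\ll Q_2$ on a space $\Omega$ and a convex function $\phi:[0,\infty)\to(-\infty,\infty]$ such that $\phi(x)$ is finite for all $x>0$, $\phi(1)=0$ and $\phi(0)=\lim_{t\to0^+}\phi(t)$ (possibly infinite), the $\phi$-divergence of $Q_1$ from $Q_2$ is $$D_\phi(Q_1\|Q_2)=\int_\Omega\phi\Big(\frac{\mathrm{d}Q_1}{\mathrm{d}Q_2}\Big)\,\mathrm{d}Q_2 .$$ The set $\mathcal{K}$ consists of distributions $Q$ on $\mathcal{Z}$ with $Q\ll P_0$. It is implicitly assumed that $f^*$ and $f^*_{\phi\text{-dro}}$ exist, that the expectations and maxima appearing are well defined and finite, and that the relevant events are measurable. *)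

(* Defs.v *)
From HB Require Import structures.
From mathcomp Require Import all_boot all_order all_algebra.
From mathcomp Require Import all_classical all_reals all_analysis.
Import Order.TTheory GRing.Theory Num.Theory.
Import numFieldNormedType.Exports.

Set Implicit Arguments.
Unset Strict Implicit.
Unset Printing Implicit Defensive.

Local Open Scope classical_set_scope.
Local Open Scope ring_scope.
Local Open Scope ereal_scope.

(* MathComp-Analysis requires measurable spaces to be pointed: [a] serves only
   to witness that [A] is nonempty. *)
Definition pointed_subset (T : choiceType) (A : set T) (a : A) : Type := A.

HB.instance Definition _ (T : choiceType) (A : set T) (a : A) :=
  Choice.copy (pointed_subset a) A.
HB.instance Definition _ (T : choiceType) (A : set T) (a : A) :=
  isPointed.Build (pointed_subset a) a.

Definition subset_val (T : choiceType) (A : set T) (a : A) :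
  pointed_subset a -> T := @set_val T A.
Arguments subset_val {T A} a x.

(* A subset of R^d, with the trace of the Borel sigma-algebra of R^d. *)
Notation sample_space z0 := (g_sigma_algebra_preimageType (subset_val z0)).

(* phi : [0, +oo) -> (-oo, +oo]; the values of [phi] on negative reals are
   irrelevant.  With the convention 0 * +oo = 0, the convexity inequality is
   also meaningful at the endpoints t = 0 and t = 1. *)
Record divergence_function (R : realType) (phi : R -> \bar R) : Prop := {
  divf_convex : forall x y t : R, (0 <= x)%R -> (0 <= y)%R ->
    (0 <= t <= 1)%R ->
    phi (t * x + (1 - t) * y)%R <= t%:E * phi x + (1 - t)%:E * phi y ;
  divf_gtNy : forall x : R, (0 <= x)%R -> -oo < phi x ;
  divf_fin : forall x : R, (0 < x)%R -> phi x \is a fin_num ;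
  divf_at1 : phi 1%R = 0 ;
  divf_at0 : phi t @[t --> (0 : R)^'+] --> phi 0%R }.

Section divergence.
Context (d : measure_display) (T : measurableType d) (R : realType).
Implicit Types Q : probability T R.

(* [Radon_Nikodym_SigmaFinite.f Q1 Q2] is a version of dQ1/dQ2 that is finite
   and nonnegative everywhere when Q1 << Q2; it is junk otherwise, so every use
   of [phi_divergence] must come with Q1 << Q2. *)
Definition phi_divergence (phi : R -> \bar R) Q1 Q2 : \bar R :=
  \int[Q2]_x phi (fine (Radon_Nikodym_SigmaFinite.f Q1 Q2 x)).

Definition ambiguity_set (phi : R -> \bar R) (eta : R) (P0 : probability T R) :
  set (probability T R) :=
  [set Q : probability T R | Q `<< P0 /\ phi_divergence phi Q P0 <= eta%:E].

(* A supremum in general; it is the maximum under [attains_max]. *)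
Definition max_expectation (K : set (probability T R)) (g : T -> R) : \bar R :=
  ereal_sup [set 'E_Q[g] | Q in K].

Definition attains_max (K : set (probability T R)) (g : T -> R) : Prop :=
  exists2 Q, K Q & 'E_Q[g] = max_expectation K g.

Definition has_expectation Q (g : T -> R) : Prop :=
  Q.-integrable [set: T] (EFin \o g).

End divergence.

Definition argmin (A : Type) (R : realType) (g : A -> \bar R) : set A :=
  [set a | forall b, g a <= g b].

(* The sets [A i] may be the whole space, so the product rule for every
   subfamily is included. *)
Definition mutually_independent (d d' : measure_display)
    (Omega : measurableType d) (T : measurableType d') (R : realType)
    (Pr : probability Omega R) (n : nat) (z : 'I_n -> {RV Pr >-> T}) : Prop :=
  forall A : 'I_n -> set T, (forall i, measurable (A i)) ->
    Pr [set w | forall i, A i (z i w)] = \prod_(i < n) Pr (z i @^-1` A i).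

Definition iid_samples (d d' : measure_display)
    (Omega : measurableType d) (T : measurableType d') (R : realType)
    (Pr : probability Omega R) (P : probability T R)
    (n : nat) (z : 'I_n -> {RV Pr >-> T}) : Prop :=
  mutually_independent z /\
  forall (i : 'I_n) (A : set T), measurable A -> distribution Pr (z i) A = P A.

Definition sample (d d' : measure_display)
    (Omega : measurableType d) (T : measurableType d') (R : realType)
    (Pr : probability Omega R) (n : nat) (z : 'I_n -> {RV Pr >-> T})
    (w : Omega) : 'I_n -> T :=
  fun i => z i w.

(* Main.v *)
Require Import Defs.
From HB Require Import structures.
From mathcomp Require Import all_boot all_order all_algebra.
From mathcomp Require Import all_classical all_reals all_analysis.
From mathcomp Require Import lra.
Import Order.TTheory GRing.Theory Num.Theory.
Import numFieldNormedType.Exports.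

Set Implicit Arguments.
Unset Strict Implicit.
Unset Printing Implicit Defensive.

Local Open Scope classical_set_scope.
Local Open Scope ring_scope.
Local Open Scope ereal_scope.

(** The excess risk of the robust solution is controlled on the event where the
    ambiguity set contains [P] and the baseline approximation bound holds.
    There the expected loss of the robust solution under [P] is at most its
    worst-case expected loss, which by minimality is at most the worst-case
    expected loss of [fstar]; the latter exceeds the expected loss of [fstar]
    under the baseline by at most [C1], and that one exceeds the expected loss
    of [fstar] under [P] by at most [C2].  Each of the two conditions fails with
    probability at most [delta / 2], so both hold with probability at least
    [1 - delta] by the union bound, [probability_setI_ge]. *)

Lemma has_expectation_fin_num (d : measure_display) (T : measurableType d)
    (R : realType) (Q : probability T R) (g : T -> R) :
  has_expectation Q g -> 'E_Q[g] \is a fin_num.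
Proof. by move=> Qg; rewrite unlock; exact: integrable_fin_num. Qed.

Lemma expectation_le_max (d : measure_display) (T : measurableType d)
    (R : realType) (K : set (probability T R)) (Q : probability T R)
    (g : T -> R) :
  K Q -> 'E_Q[g] <= max_expectation K g.
Proof. by move=> KQ; apply: ereal_sup_ubound; exists Q. Qed.

(** The union bound, stated for the intersection of two likely events. *)
Lemma probability_setI_ge (d : measure_display) (T : measurableType d)
    (R : realType) (Pr : probability T R) (A B : set T) (a b : R) :
  measurable A -> measurable B ->
  (1 - a)%:E <= Pr A -> (1 - b)%:E <= Pr B ->
  (1 - (a + b))%:E <= Pr (A `&` B).
Proof.
move=> mA mB PA PB.
have mAB : measurable (A `&` B) by exact: measurableI.
have : Pr (~` (A `&` B)) <= Pr (~` A) + Pr (~` B).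
  by rewrite setCI; apply: measureU2; exact: measurableC.
rewrite !probability_setC //.
move: PA PB.
rewrite -(fineK (fin_num_measure Pr _ mA)) -(fineK (fin_num_measure Pr _ mB)).
rewrite -(fineK (fin_num_measure Pr _ mAB)).
rewrite -!EFinB -EFinD !lee_fin; lra.
Qed.

Theorem theoremD4 (R : realType) (d : nat)
  (Z : set (d.-tuple R)) (z0 : Z)
  (P : probability (sample_space z0) R)
  (dO : measure_display) (Omega : measurableType dO) (Pr : probability Omega R)
  (n : nat) (z : 'I_n -> {RV Pr >-> sample_space z0})
  (z_iid : iid_samples P z)
  (X Y : Type) (F : set (X -> Y)) (loss : F -> sample_space z0 -> R)
  (loss_P : forall f : F, has_expectation P (loss f))
  (fstar : F) (fstar_min : argmin (fun f : F => 'E_P[loss f]) fstar)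
  (P0 : ('I_n -> sample_space z0) -> probability (sample_space z0) R)
  (phi : R -> \bar R) (phi_div : divergence_function phi)
  (delta eta : R) (delta_bounds : (0 < delta < 1)%R) (eta_ge0 : (0 <= eta)%R)
  (K : Omega -> set (probability (sample_space z0) R))
  (K_def : forall w, K w = ambiguity_set phi eta (P0 (sample z w)))
  (loss_P0 : forall w, has_expectation (P0 (sample z w)) (loss fstar))
  (loss_K : forall w Q, K w Q -> forall f : F, has_expectation Q (loss f))
  (max_K : forall w (f : F), attains_max (K w) (loss f))
  (C1 : (sample_space z0 -> R) -> R -> (R -> \bar R) -> R)
  (C2 : (sample_space z0 -> R) -> nat -> R -> R)
  (high_confidence_meas : measurable [set w | K w P])
  (high_confidence : (1 - delta / 2)%:E <= Pr [set w | K w P])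
  (dro_bound : forall w,
    max_expectation (K w) (loss fstar) - 'E_(P0 (sample z w))[loss fstar]
      <= (C1 (loss fstar) (Num.sqrt eta) phi)%:E)
  (approximation_meas : measurable
    [set w | 'E_(P0 (sample z w))[loss fstar] - 'E_P[loss fstar]
             <= (C2 (loss fstar) n delta)%:E])
  (approximation : (1 - delta / 2)%:E <= Pr
    [set w | 'E_(P0 (sample z w))[loss fstar] - 'E_P[loss fstar]
             <= (C2 (loss fstar) n delta)%:E])
  (fdro : ('I_n -> sample_space z0) -> F)
  (fdro_min : forall w,
    argmin (fun f : F => max_expectation (K w) (loss f)) (fdro (sample z w)))
  (excess_risk_meas : measurable
    [set w | 'E_P[loss (fdro (sample z w))] - 'E_P[loss fstar]
             <= (C1 (loss fstar) (Num.sqrt eta) phi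
                 + C2 (loss fstar) n delta)%:E]) :
  (1 - delta)%:E <= Pr
    [set w | 'E_P[loss (fdro (sample z w))] - 'E_P[loss fstar]
             <= (C1 (loss fstar) (Num.sqrt eta) phi
                 + C2 (loss fstar) n delta)%:E].
Proof.
rewrite [in leLHS](splitr delta).
apply: (le_trans (probability_setI_ge high_confidence_meas approximation_meas
  high_confidence approximation)).
apply: le_measure; rewrite ?inE.
- exact: measurableI.
- exact: excess_risk_meas.
move=> w [KP approx] /=.
have [Q KQ maxQ] := max_K w fstar.
have robust_le : 'E_P[loss (fdro (sample z w))] <= 'E_Q[loss fstar].
  by rewrite maxQ; exact: le_trans (expectation_le_max _ KP) (fdro_min w fstar).
move: robust_le approx (dro_bound w); rewrite -maxQ /=.
(* All four expectations are finite, so real arithmetic applies. *)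
rewrite -(fineK (has_expectation_fin_num (loss_P (fdro (sample z w))))).
rewrite -(fineK (has_expectation_fin_num (loss_P fstar))).
rewrite -(fineK (has_expectation_fin_num (loss_P0 w))).
rewrite -(fineK (has_expectation_fin_num (loss_K w Q KQ fstar))).
rewrite -!EFinB !lee_fin; lra.
Qed.
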